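(* Let $e,m,n$ be integers with $2\le m<n\le e-2$, and let $F(S^e(m,n))$ denote the Frobenius number of $S^e(m,n)$. Then $$F(S^e(m,n))=\begin{cases}2e+3, & (m,n)=(2,3),\\ e+n, & \text{otherwise.}\end{cases}$$
   Context: For integers $e,m,n$ with $2\le m<n\le e-2$, $S^e(m,n)$ denotes the Sally type numerical semigroup, i.e. the numerical semigroup (submonoid of $(\mathbb N,+)$, with $0\in\mathbb N$) minimally generated by $\{e,e+1,\ldots,2e-1\}\setminus\{e+m,e+n\}$. The Frobenius number of a numerical semigroup $S$ is the greatest integer not in $S$. *)

(* Defs.v *)
From mathcomp Require Import all_boot all_order all_algebra.
From mathcomp Require Import boolp classical_sets functions cardinality.
From mathcomp Require Import zify.

Set Implicit Arguments.
Unset Strict Implicit.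
Unset Printing Implicit Defensive.

Local Open Scope classical_set_scope.
Local Open Scope nat_scope.

Definition submonoid (S : set nat) : Prop :=
  S 0 /\ (forall x y, S x -> S y -> S (x + y)).

Definition numerical_semigroup (S : set nat) : Prop :=
  submonoid S /\ finite_set (~` S).

Definition generated (A : set nat) : set nat := smallest submonoid A.

Definition minimally_generated (S A : set nat) : Prop :=
  generated A = S /\ (forall B, B `<` A -> generated B <> S).

(* The maximum is taken over int rather than nat, so that the Frobenius number
   of the full semigroup nat is -1. *)
Definition is_frobenius_number (S : set nat) (f : int) : Prop :=
  let gaps : set int := ~` [set (s%:Z)%R | s in S] in
  gaps f /\ ubound gaps f.

Definition sally_generators (e m n : nat) : set nat :=
  [set x | e <= x <= 2 * e - 1] `\` [set e + m; e + n].

Definition sally (e m n : nat) : set nat := generated (sally_generators e m n).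

Lemma generated_submonoid (A : set nat) : submonoid (generated A).
Proof.
split; first by move=> M [[M0 _] _].
move=> x y Sx Sy M MA; have [[_ MD] _] := MA.
by apply: MD; [exact: Sx | exact: Sy].
Qed.

Lemma sally_numerical_semigroup (e m n : nat) :
  2 <= m -> m < n -> n <= e - 2 -> numerical_semigroup (sally e m n).
Proof.
move=> m2 mn ne.
have [S0 SD] := generated_submonoid (sally_generators e m n).
split; first by split.
have SM k x : sally e m n x -> sally e m n (k * x).
  by move=> Sx; elim: k => [|k IHk]; rewrite ?mul0n // mulSn; apply: SD.
have Se : sally e m n e.
  by apply: sub_gen_smallest; split; rewrite /=; [lia | case; lia].
have Se1 : sally e m n e.+1.
  by apply: sub_gen_smallest; split; rewrite /=; [lia | case; lia].
apply: (@sub_finite_set _ _ `I_(e * e)); last exact: finite_II.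
move=> x /= nSx; rewrite ltnNge; apply/negP => ex; apply: nSx.
have re : x %% e < e by rewrite ltn_mod; lia.
have qe : e <= x %/ e by rewrite leq_divRL //; lia.
have -> : x = (x %% e) * e.+1 + (x %/ e - x %% e) * e.
  by rewrite mulnBl {1}(divn_eq x e); nia.
by apply: SD; apply: SM.
Qed.

Lemma sally_minimally_generated (e m n : nat) :
  2 <= m -> m < n -> n <= e - 2 ->
  minimally_generated (sally e m n) (sally_generators e m n).
Proof.
move=> m2 mn ne; split=> // B [BA AB] BS; apply: AB => a Aa.
have : generated B a by rewrite BS; apply: sub_gen_smallest.
have BM : submonoid [set x | [\/ x = 0, B x | 2 * e <= x]].
  have Be x : B x -> e <= x by move=> /BA[/= /andP[]].
  split=> [|x y]; first by constructor 1.
  move=> [->|Bx|ex] [->|By|ey]; rewrite /= ?addn0 ?add0n;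
    by [constructor 1 | constructor 2 | constructor 3; lia
       | constructor 3; have := Be _ Bx; try have := Be _ By; lia
       | constructor 3; have := Be _ By; lia].
move=> /(_ _ (conj BM _)) []; first by move=> x Bx; constructor 2.
- by move: Aa => [/= /andP[ea _] _] a0; lia.
- by [].
- by move: Aa => [/= /andP[ea a2] _] ?; lia.
Qed.

(* Main.v *)
Require Import Defs.
From mathcomp Require Import all_boot all_order all_algebra.
From mathcomp Require Import boolp classical_sets functions cardinality.
From mathcomp Require Import zify.

(** Write S for the Sally type semigroup, whose generators all lie in
    [e, 2e - 1].

    Elements of S below 3e are sums of at most two generators
    ([generated_lt3]), so non-membership is a finite check.  The number e + n
    is an excluded one below 2e.  For (m, n) = (2, 3), the number 2e + 3 would
    have to be (e + i) + (e + j) with i + j = 3, and both decompositions 0 + 3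
    and 1 + 2 use an excluded index.

    Conversely, as e is in S, one window of e consecutive elements of S yields
    everything above it ([submonoid_window]).  In the general case the numbers
    between e + n and 2e are generators, and the window is [2e, 3e - 1]:
    2e + i is e + (e + i) unless i is m or n, and these two indices are reached
    by the splittings m = 1 + (m - 1) and n = 1 + (n - 1), or n = 2 + (n - 2)
    when n - 1 is the excluded index m.  The last splitting is blocked only when
    m = 2, that is for (m, n) = (2, 3); there the window is [2e + 4, 3e + 3]. *)

Local Open Scope classical_set_scope.
Local Open Scope nat_scope.

Lemma is_frobenius_number_nat (S : set nat) (f : nat) :
  ~ S f -> (forall x, f < x -> S x) -> is_frobenius_number S (Posz f).
Proof.
move=> nSf Sgt; split=> [[s Ss [sf]]|[k|k] gap_k]; first by apply: nSf; rewrite -sf.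
  by rewrite lez_nat leqNgt; apply/negP => /Sgt Sk; apply: gap_k; exists k.
by lia.
Qed.

Lemma submonoid_window (S : set nat) (e c : nat) :
  submonoid S -> 0 < e -> S e ->
  (forall x, c <= x < c + e -> S x) -> forall x, c <= x -> S x.
Proof.
move=> [_ SD] e0 Se window; elim/ltn_ind => x IHx cx.
have [x_lt|x_ge] := ltnP x (c + e); first by apply: window; lia.
by rewrite -(subnK (_ : e <= x)); [apply: SD => //; apply: IHx; lia | lia].
Qed.

(** A sum of three or more generators is at least 3e.  Adjoining all numbers
    at least 3e to the sums of at most two generators gives a submonoid, which
    therefore contains the generated one. *)
Lemma generated_lt3 (A : set nat) (e x : nat) :
  (forall a, A a -> e <= a) -> generated A x -> x < 3 * e ->
  [\/ x = 0, A x | exists a b, [/\ A a, A b & x = a + b]].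
Proof.
move=> Age Sx x_lt.
pose M : set nat := [set y | [\/ y = 0, A y,
  exists a b, [/\ A a, A b & y = a + b] | 3 * e <= y]].
have MM : submonoid M.
  split=> [|y z]; first by constructor 1.
  move=> [->|Ay|[a [b [Aa Ab ->]]]|y_ge].
  - by rewrite add0n.
  - move=> [->|Az|[c [d [Ac Ad ->]]]|z_ge].
    + by rewrite addn0; constructor 2.
    + by constructor 3; exists y, z.
    + by constructor 4; have := Age _ Ay; have := Age _ Ac;
        have := Age _ Ad; lia.
    + by constructor 4; lia.
  - move=> [->|Az|[c [d [Ac Ad ->]]]|z_ge].
    + by rewrite addn0; constructor 3; exists a, b.
    + by constructor 4; have := Age _ Aa; have := Age _ Ab;
        have := Age _ Az; lia.
    + by constructor 4; have := Age _ Aa; have := Age _ Ab;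
        have := Age _ Ac; lia.
    + by constructor 4; lia.
  - by move=> _; constructor 4; lia.
have AM : A `<=` M by move=> y Ay; constructor 2.
have [?|?|?|] := Sx M (conj MM AM); [exact: Or31|exact: Or32|exact: Or33|lia].
Qed.

(** For e = 0 the truncated bound 2 * e - 1 is 0, so the interval of generators
    would be [0, 0] instead of empty; hence the positivity assumption. *)
Lemma sally_generatorsP (e m n i : nat) : 0 < e ->
  sally_generators e m n (e + i) <-> [/\ i < e, i <> m & i <> n].
Proof.
move=> e0; split=> [[/= bounds excl]|[ie im i_n]].
  split; first by lia.
    by move=> im; apply: excl; left; rewrite im.
  by move=> i_n; apply: excl; right; rewrite i_n.
by split=> /=; [lia | case; lia].
Qed.

Lemma sally_generators_shift (e m n a : nat) : 0 < e ->
  sally_generators e m n a ->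
  exists i, [/\ a = e + i, i < e, i <> m & i <> n].
Proof.
move=> e0 Ga; have ea : e <= a by case: Ga => /= /andP[].
have aE : a = e + (a - e) by lia.
by exists (a - e); split=> //; move: Ga; rewrite {1}aE => /(sally_generatorsP _ _ _ _ e0)[].
Qed.

Lemma sally_gen (e m n i : nat) :
  i < e -> i <> m -> i <> n -> sally e m n (e + i).
Proof.
by move=> ? ? ?; apply: sub_gen_smallest; apply/sally_generatorsP => //; lia.
Qed.

Lemma sally_gen2 (e m n i j : nat) :
  i < e -> i <> m -> i <> n -> j < e -> j <> m -> j <> n ->
  sally e m n (2 * e + (i + j)).
Proof.
move=> ? ? ? ? ? ?; have -> : 2 * e + (i + j) = (e + i) + (e + j) by lia.
by apply: (generated_submonoid _).2; apply: sally_gen.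
Qed.

Lemma sally_lt3 (e m n x : nat) :
  sally e m n x -> 0 < x < 3 * e ->
  (exists i, [/\ x = e + i, i < e, i <> m & i <> n]) \/
  (exists i j, [/\ x = 2 * e + (i + j), i <> m /\ i <> n & j <> m /\ j <> n]).
Proof.
have Gge a : sally_generators e m n a -> e <= a by case=> /= /andP[].
move=> Sx /andP[x0 x_lt]; have e0 : 0 < e by lia.
have [x_eq0|/(sally_generators_shift _ _ _ _ e0) Gx|[a [b [Ga Gb ->]]]] :=
  generated_lt3 _ _ _ Gge Sx x_lt.
- by rewrite x_eq0 in x0.
- by left.
have [i [-> _ im i_n]] := sally_generators_shift _ _ _ _ e0 Ga.
have [j [-> _ jm jn]] := sally_generators_shift _ _ _ _ e0 Gb.
by right; exists i, j; split=> //; lia.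
Qed.

Lemma sally_23_gap (e : nat) : 5 <= e -> ~ sally e 2 3 (2 * e + 3).
Proof.
by move=> e5 /sally_lt3[|[i [? ? ? ?]]|[i [j [? [? ?] [? ?]]]]]; lia.
Qed.

Lemma sally_23_above (e : nat) :
  5 <= e -> forall x, 2 * e + 3 < x -> sally e 2 3 x.
Proof.
move=> e5; have SM := generated_submonoid (sally_generators e 2 3).
have Se : sally e 2 3 e by rewrite -[X in sally _ _ _ X]addn0; apply: sally_gen; lia.
have Se1 : sally e 2 3 (e + 1) by apply: sally_gen; lia.
apply: (submonoid_window _ e) => //; first by lia.
move=> x x_bd; have [x_lt|x_ge] := ltnP x (3 * e).
  have -> : x = 2 * e + (0 + (x - 2 * e)) by lia.
  by apply: sally_gen2; lia.
(* The remaining elements 3e, ..., 3e + 3 are sums of copies of e and e + 1. *)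
have S2 i : i <= 2 -> sally e 2 3 (2 * e + i).
  case: i => [|[|[|//]]] _.
  - by apply: (sally_gen2 e 2 3 0 0); lia.
  - by apply: (sally_gen2 e 2 3 0 1); lia.
  - by apply: (sally_gen2 e 2 3 1 1); lia.
have [x_le|x_gt] := leqP x (3 * e + 2).
  have -> : x = e + (2 * e + (x - 3 * e)) by lia.
  by apply: SM.2 => //; apply: S2; lia.
have -> : x = (e + 1) + (2 * e + 2) by lia.
by apply: SM.2 => //; apply: S2.
Qed.

Lemma sally_gap (e m n : nat) :
  2 <= m -> m < n -> n <= e - 2 -> ~ sally e m n (e + n).
Proof.
by move=> m2 mn ne /sally_lt3[|[i [? ? ? ?]]|[i [j [? _ _]]]]; lia.
Qed.

Lemma sally_above (e m n : nat) :
  2 <= m -> m < n -> n <= e - 2 -> ~ (m = 2 /\ n = 3) ->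
  forall x, e + n < x -> sally e m n x.
Proof.
move=> m2 mn ne mn23 x x_gt.
have [x_lt|] := ltnP x (2 * e).
  have -> : x = e + (x - e) by lia.
  by apply: sally_gen; lia.
move: x {x_gt}; apply: (submonoid_window _ e).
- exact: generated_submonoid.
- by lia.
- by rewrite -[X in sally _ _ _ X]addn0; apply: sally_gen; lia.
move=> x x_bd; set i := x - 2 * e.
have ie : i < e by lia.
have -> : x = 2 * e + i by lia.
have [im|im] := eqVneq i m.
  have -> : i = 1 + (m - 1) by lia.
  by apply: sally_gen2; lia.
have [i_n|i_n] := eqVneq i n.
  have [nm|nm] := eqVneq (n - 1) m.
    have -> : i = 2 + (n - 2) by lia.
    by apply: sally_gen2; lia.
  have -> : i = 1 + (n - 1) by lia.
  by apply: sally_gen2; lia.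
by rewrite -[i]add0n; apply: sally_gen2; lia.
Qed.

Theorem proposition2p2 (e m n : nat) (hm : 2 <= m) (hmn : m < n)
    (hn : n <= e - 2) :
  is_frobenius_number (sally e m n)
    (Posz (if (m == 2) && (n == 3) then 2 * e + 3 else e + n)).
Proof.
case: ifP => [/andP[/eqP m2 /eqP n3]|mn23].
  subst m n; apply: is_frobenius_number_nat.
    by apply: sally_23_gap; lia.
  by apply: sally_23_above; lia.
apply: is_frobenius_number_nat; first exact: sally_gap.
by apply: sally_above => //; lia.
Qed.
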